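(* Let $\vartheta$ be a constant length, primitive, compatible random substitution on a finite alphabet $\mathcal A$ that admits at least one recognisable word. Then $\operatorname{Aut}(X_\vartheta)$ contains a subgroup isomorphic to the automorphism group $\operatorname{Aut}(X_2)$ of the full shift $X_2=\{0,1\}^{\mathbb Z}$.
   Context: A random substitution on $\mathcal A$ is a map $\vartheta$ from $\mathcal A$ to non-empty finite sets of non-empty words, extended to words by concatenating choices ($\vartheta(u_0\cdots u_n)=\vartheta(u_0)\cdots\vartheta(u_n)$), to sets by unions, and iterated. Legal words are subwords of words in some $\vartheta^p(a)$; $\mathcal L_\vartheta$ is the set of legal words; $X_\vartheta\subseteq\mathcal A^{\mathbb Z}$ is the set of sequences all of whose subwords are legal, with shift $\sigma$; $\operatorname{Aut}$ denotes the group of shift-commuting homeomorphisms. $\vartheta$ has constant length $L$ if all words in all $\vartheta(a)$ have length $L$; compatible if for each $a$ all words in $\vartheta(a)$ have the same letter counts; primitive if for some $p\ge1$ every letter occurs in some word of $\vartheta^p(b)$ for every $b$. Inflation word decompositions: for a legal word $u$, a pair $([u_1,\ldots,u_\ell],v)$ with non-empty words $u_i$, $u_1\cdots u_\ell=u$, and a legal word $v=v_1\cdots v_\ell$ ($v_i$ letters) such that $u_i\in\vartheta(v_i)$ for $2\le i\le \ell-1$, $u_1$ is a suffix of a word in $\vartheta(v_1)$ and $u_\ell$ is a prefix of a word in $\vartheta(v_\ell)$; $v$ is the root. A decomposition of $u$ restricts in the obvious way to an (induced) decomposition of any subword occurrence $u_{[i,j]}$ (cut the pieces at positions $i$ and $j$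 and keep the corresponding letters of the root). A legal word $u$ is recognisable if there is $N\ge0$ such that for every legal word $w=u^{(l)}uu^{(r)}$ with $|u^{(l)}|=|u^{(r)}|=N$, all inflation word decompositions of $w$ induce the same inflation word decomposition on the central occurrence of $u$. $\vartheta$ admits a recognisable word if some $u\in\mathcal L_\vartheta$ is recognisable.
   Formalization: The random substitution is additionally assumed to be nondeterministic (some letter has at least two distinct images); for deterministic substitutions such as Thue–Morse, whose automorphism group is abelian, the claim fails. *)

(* Defs.v *)
From mathcomp Require Import all_boot all_order all_algebra.
Set Implicit Arguments. Unset Strict Implicit. Unset Printing Implicit Defensive.
Import Order.TTheory GRing.Theory Num.Theory.

Section RandomSubstitutions.
Variable A : finType.

Definition rsubst := A -> seq (seq A).

Definition is_random_subst (theta : rsubst) : Prop :=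
  (forall a, theta a != [::]) /\ (forall a w, w \in theta a -> w != [::]).

Fixpoint subst_word (theta : rsubst) (u w : seq A) : Prop :=
  match u with
  | [::] => w = [::]
  | a :: u' => exists w1 w2, [/\ w1 \in theta a, subst_word theta u' w2 & w = w1 ++ w2]
  end.

Fixpoint subst_iter (theta : rsubst) (p : nat) (u w : seq A) : Prop :=
  match p with
  | 0 => w = u
  | p'.+1 => exists v, subst_iter theta p' u v /\ subst_word theta v w
  end.

Definition legal (theta : rsubst) (u : seq A) : Prop :=
  exists a p w, subst_iter theta p [:: a] w /\ infix u w.

Definition constant_length (theta : rsubst) (L : nat) : Prop :=
  forall a w, w \in theta a -> size w = L.

Definition compatible (theta : rsubst) : Prop :=
  forall a u v, u \in theta a -> v \in theta a ->
    forall b, count_mem b u = count_mem b v.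

Definition primitive (theta : rsubst) : Prop :=
  exists p, 0 < p /\ forall a b, exists w, subst_iter theta p [:: b] w /\ a \in w.

Definition nondeterministic (theta : rsubst) : Prop :=
  exists a, 1 < size (undup (theta a)).

Definition is_decomp (theta : rsubst) (u : seq A) (d : seq (seq A) * seq A) : Prop :=
  let us := d.1 in let v := d.2 in let z := zip us v in
  [/\ size us = size v,
      all (fun p => p != [::]) us,
      flatten us = u &
      legal theta v] /\
  [/\ (forall pc, pc \in drop 1 (take (size z).-1 z) -> pc.1 \in theta pc.2),
      (forall pc, ohead z = Some pc -> exists w, w \in theta pc.2 /\ suffix pc.1 w) &
      (forall pc, ohead (rev z) = Some pc -> exists w, w \in theta pc.2 /\ prefix pc.1 w)].

(* Restriction of a decomposition (given as zipped pairs (piece, root letter),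
   the first piece starting at position s) to the occurrence [i, j). *)
Fixpoint induced_aux (s : nat) (z : seq (seq A * A)) (i j : nat) : seq (seq A * A) :=
  match z with
  | [::] => [::]
  | (p, c) :: z' =>
      let e := s + size p in
      let rest := induced_aux e z' i j in
      if maxn s i < minn e j
      then (take (minn e j - maxn s i) (drop (i - s) p), c) :: rest
      else rest
  end.

Definition induced (d : seq (seq A) * seq A) (i j : nat) : seq (seq A) * seq A :=
  let r := induced_aux 0 (zip d.1 d.2) i j in (unzip1 r, unzip2 r).

Definition recognisable (theta : rsubst) (u : seq A) : Prop :=
  exists N : nat, forall ul ur : seq A, size ul = N -> size ur = N ->
    legal theta (ul ++ u ++ ur) ->
    forall d1 d2, is_decomp theta (ul ++ u ++ ur) d1 -> is_decomp theta (ul ++ u ++ ur) d2 ->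
      induced d1 N (N + size u) = induced d2 N (N + size u).

Definition admits_recognisable_word (theta : rsubst) : Prop :=
  exists u, [/\ u != [::], legal theta u & recognisable theta u].

End RandomSubstitutions.

Definition config (B : Type) := int -> B.

Definition shift (B : Type) (x : config B) : config B := fun i => x (i + 1)%R.

Definition X_theta (A : finType) (theta : rsubst A) (x : config A) : Prop :=
  forall (i : int) (n : nat), legal theta [seq x (i + k%:Z)%R | k <- iota 0 n].

Definition full_shift (B : Type) (x : config B) : Prop := True.

Definition agree (B : Type) (n : nat) (x y : config B) : Prop :=
  forall i : int, (- (n%:Z) <= i <= n%:Z)%R -> x i = y i.

(* continuity on X for the product topology of the discrete topologies *)
Definition cont_on (B C : Type) (X : config B -> Prop) (f : config B -> config C) : Prop :=
  forall x, X x -> forall n : nat, exists m : nat,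
    forall y, X y -> agree m x y -> agree n (f x) (f y).

Definition is_aut (B : Type) (X : config B -> Prop) (f : config B -> config B) : Prop :=
  [/\ forall x, X x -> X (f x),
      forall x, X x -> f (shift x) = shift (f x),
      cont_on X f &
      exists g : config B -> config B,
        [/\ forall x, X x -> X (g x), cont_on X g,
            forall x, X x -> g (f x) = x & forall x, X x -> f (g x) = x]].

(* Aut(X) contains a subgroup isomorphic to Aut(Y): there is an injective
   group homomorphism Aut(Y) -> Aut(X) (automorphisms identified when they
   agree on the subshift). *)
Definition aut_embeds (B C : Type) (Y : config B -> Prop) (X : config C -> Prop) : Prop :=
  exists Phi : (config B -> config B) -> (config C -> config C),
    [/\ forall f, is_aut Y f -> is_aut X (Phi f),
        forall f g, is_aut Y f -> is_aut Y g ->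
          forall x, X x -> Phi (fun y => f (g y)) x = Phi f (Phi g x) &
        forall f g, is_aut Y f -> is_aut Y g ->
          (forall x, X x -> Phi f x = Phi g x) -> forall y, Y y -> f y = g y].

(* Main.v *)
(** The full shift acts through a "conveyor belt".  Call a set of words of equal
    length exchangeable in a context if substituting one for another there never
    affects legality.  Among the contexts [(p, q)] admitting at least one filler
    of a fixed large length, one with the fewest fillers makes all its fillers
    exchangeable, because any larger context still admitting a filler admits
    them all.  Nondeterminism and primitivity provide at least four fillers, and
    exponential growth of the language provides a word that marks the places
    where they occur, so that cells, each storing two bits, do not interfere.
    The upper bits of neighbouring cells, read rightwards, and the lower bits,
    read leftwards, form a belt (turning round where there is no next cell within
    distance [R]); an automorphism of the full shift acts on the bit sequences
    read along the belts.  It acts faithfully since arbitrarily long chains of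
    cells occur. *)
Require Import Defs.
From mathcomp Require Import all_boot all_order all_algebra.
From mathcomp Require Import boolp zify.
Set Implicit Arguments. Unset Strict Implicit. Unset Printing Implicit Defensive.

(** * Legal words *)

Section Words.
Variables (A : finType) (theta : rsubst A) (L : nat).
Implicit Types (u v w : seq A) (a b : A).

Lemma subst_word_cat u1 u2 w : subst_word theta (u1 ++ u2) w <->
  exists w1 w2, [/\ subst_word theta u1 w1, subst_word theta u2 w2 & w = w1 ++ w2].
Proof.
elim: u1 w => [|a u1 IH] w /=.
  by split=> [h|[w1 [w2 [-> h ->]]]]; first by exists [::], w.
split=> [[x [y [ax /IH[y1 [y2 [h1 h2 ->]]] ->]]]|[x [y [[x1 [x2 [ax h1 ->]]] h2 ->]]]].
  by exists (x ++ y1), y2; split; rewrite ?catA //; exists x, y1.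
by exists x1, (x2 ++ y); split; rewrite ?catA //; apply/IH; exists x2, y.
Qed.

Lemma subst_iter_nil p w : subst_iter theta p [::] w <-> w = [::].
Proof.
elim: p w => [|p IH] w //=; split=> [[v [/IH-> /= ->]] //|->].
by exists [::]; split=> //; apply/IH.
Qed.

Lemma subst_iter_cat p u1 u2 w : subst_iter theta p (u1 ++ u2) w <->
  exists w1 w2, [/\ subst_iter theta p u1 w1, subst_iter theta p u2 w2 & w = w1 ++ w2].
Proof.
elim: p w => [|p IH] w /=.
  by split=> [->|[w1 [w2 [-> -> ->]]]] //; exists u1, u2.
split=> [[v [/IH[v1 [v2 [h1 h2 ->]]] /subst_word_cat[w1 [w2 [g1 g2 ->]]]]]|].
  by exists w1, w2; split=> //; [exists v1 | exists v2].
move=> [w1 [w2 [[v1 [h1 g1]] [v2 [h2 g2]] ->]]]; exists (v1 ++ v2).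
by split; [apply/IH; exists v1, v2 | apply/subst_word_cat; exists w1, w2].
Qed.

Lemma subst_iter_add p q u w : subst_iter theta (p + q) u w <->
  exists v, subst_iter theta p u v /\ subst_iter theta q v w.
Proof.
elim: q w => [|q IH] w; first by rewrite addn0 /=; split=> [h|[v [h ->]]] //; exists w.
rewrite addnS /=; split=> [[v [/IH[v0 [h1 h2]] h3]]|[v0 [h1 [v [h2 h3]]]]].
  by exists v0; split=> //; exists v.
by exists v; split=> //; apply/IH; exists v0.
Qed.

Lemma legal_infix u w : legal theta w -> infix u w -> legal theta u.
Proof. by move=> [a [p [x [hx wx]]]] uw; exists a, p, x; split=> //; apply: infix_trans wx. Qed.

Lemma legal_cat3 l u r : legal theta (l ++ u ++ r) -> legal theta u.
Proof. by move/legal_infix; apply; apply/infixP; exists l, r. Qed.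

Hypothesis theta_len : constant_length theta L.

Lemma size_subst_word u w : subst_word theta u w -> size w = size u * L.
Proof.
elim: u w => [|a u IH] w /=; first by move->.
by move=> [x [y [/theta_len hx /IH hy ->]]]; rewrite size_cat hx hy mulSn.
Qed.

Lemma size_subst_iter p u w : subst_iter theta p u w -> size w = size u * L ^ p.
Proof.
elim: p w => [|p IH] w /=; first by move->; rewrite muln1.
by move=> [v [/IH hv /size_subst_word ->]]; rewrite hv expnSr mulnA.
Qed.

Hypothesis theta_ok : is_random_subst theta.

Lemma subst_iter_ex p u : exists w, subst_iter theta p u w.
Proof.
have one v : exists w, subst_word theta v w.
  elim: v => [|a v [w hw]] /=; first by exists [::].
  case: (theta a) (theta_ok.1 a) => [//|x s] _.
  by exists (x ++ w), x, w; rewrite inE eqxx.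
elim: p => [|p [w hw]] /=; first by exists u.
by have [x hx] := one w; exists x, w.
Qed.

(** Since every letter has an image, the surroundings of [u] in a generated word can be given
    arbitrary images around [w]. *)
Lemma subst_iter_legal p u w : legal theta u -> subst_iter theta p u w -> legal theta w.
Proof.
move=> [a [q [v [hv /infixP[l [r e]]]]]] hw.
have [wl hl] := subst_iter_ex p l; have [wr hr] := subst_iter_ex p r.
exists a, (q + p), (wl ++ w ++ wr); split; last by apply/infixP; exists wl, wr.
apply/subst_iter_add; exists v; split=> //; rewrite e.
apply/subst_iter_cat; exists wl, (w ++ wr); split=> //.
by apply/subst_iter_cat; exists w, wr.
Qed.

Lemma legal1 a : legal theta [:: a].
Proof. by exists a, 0, [:: a]; rewrite infix_refl. Qed.

Hypothesis theta_prim : primitive theta.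
Hypothesis L2 : 1 < L.

(** Primitivity places the letter generating [u] below every letter after [p] steps. Surplus steps
    are performed first, since any letter they produce can serve as the starting one; hence one
    threshold for all [b]. *)
Lemma legal_realised u : legal theta u ->
  exists N0, forall N, N0 <= N -> forall b, exists w, subst_iter theta N [:: b] w /\ infix u w.
Proof.
move=> [a [k [v [hv uv]]]]; have [p [p0 hp]] := theta_prim.
exists (p + k) => N hN b.
have [v1 h1] := subst_iter_ex (N - (p + k)) [:: b].
have s1 := size_subst_iter h1.
(* [v1] is non-empty because its length is a power of [L]. *)
case: v1 h1 s1 => [_|c v1 h1 _]; first by rewrite /= mul1n => /eqP; rewrite eq_sym expn_eq0; lia.
have [v2 [h2 /splitPr s2]] := hp a c; case: s2 h2 => l r h2.
have [v3 h3] := subst_iter_ex p v1.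
have [wl hl] := subst_iter_ex k l; have [wr hr] := subst_iter_ex k (r ++ v3).
have e : N = (N - (p + k)) + p + k by lia.
exists (wl ++ v ++ wr); split; last by apply: infix_trans uv _; apply/infixP; exists wl, wr.
rewrite e; apply/subst_iter_add; exists (l ++ a :: r ++ v3); split.
  apply/subst_iter_add; exists (c :: v1); split=> //.
  by rewrite -cat1s; apply/subst_iter_cat; exists (l ++ a :: r), v3; rewrite -catA.
apply/subst_iter_cat; exists wl, (v ++ wr); split=> //.
by rewrite -cat1s; apply/subst_iter_cat; exists v, wr.
Qed.

(** As [L] is at least 2, an image of a letter has two adjacent letters [b] and [c]; after enough
    steps the image of [b] contains [u] and that of [c] contains [v]. *)
Lemma legal_transitive u v : legal theta u -> legal theta v ->
  exists g, legal theta (u ++ g ++ v).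
Proof.
move=> hu hv; have [a _] := hu.
have [N1 r1] := legal_realised hu; have [N2 r2] := legal_realised hv.
pose N := maxn N1 N2.
have [w hw] := subst_iter_ex 1 [:: a].
have sw := size_subst_iter hw; rewrite expn1 mul1n in sw.
case: w hw sw => [|b [|c w]] hw sw; rewrite /= in sw; try lia.
have [x [hx /infixP[l1 [s1 ex]]]] := r1 N (leq_maxl _ _) b.
have [y [hy /infixP[l2 [s2 ey]]]] := r2 N (leq_maxr _ _) c.
have [z hz] := subst_iter_ex N w.
exists (s1 ++ l2); apply: (@legal_cat3 l1 _ (s2 ++ z)).
apply: (@subst_iter_legal N (b :: c :: w)); first exact: subst_iter_legal (legal1 a) hw.
rewrite -cat1s; apply/subst_iter_cat; exists x, (y ++ z); split=> //.
  by rewrite -(cat1s c); apply/subst_iter_cat; exists y, z.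
by rewrite ex ey -!catA.
Qed.

Lemma legal_length a n : exists u, size u = n /\ legal theta u.
Proof.
have [w hw] := subst_iter_ex n [:: a].
exists (take n w); split.
  by rewrite size_takel // (size_subst_iter hw) mul1n ltnW // ltn_expl.
by apply: legal_infix (subst_iter_legal (legal1 a) hw) (infix_take _ _).
Qed.

(** Transitivity joins [u] on both sides to a legal word of length [n]; the surplus is then
    trimmed. *)
Lemma legal_extend u n : legal theta u ->
  exists l r, [/\ size l = n, size r = n & legal theta (l ++ u ++ r)].
Proof.
move=> hu; have [a _] := hu; have [v [sv hv]] := legal_length a n.
have [g1 h1] := legal_transitive hv hu.
have [g2 h2] := legal_transitive h1 hv.
set l := v ++ g1; set r := g2 ++ v.
have sl : n <= size l by rewrite size_cat; lia.
have sr : n <= size r by rewrite size_cat; lia.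
exists (drop (size l - n) l), (take n r).
split; [by rewrite size_drop; lia|by rewrite size_takel|].
apply: (@legal_cat3 (take (size l - n) l) _ (drop n r)).
rewrite -!catA cat_take_drop [take _ l ++ _]catA cat_take_drop.
by move: h2; rewrite /l /r -!catA.
Qed.

End Words.

(** * Exchangeable fillers and markers *)

(* Distinct occurrences of the patterns [P ++ e c ++ Q] may overlap, but the prefix
   of length [n] is a marker which keeps each filler off every other occurrence. *)
Record marked_cell (A : finType) (theta : rsubst A) (P Q : seq A)
    (e : bool * bool -> seq A) (m n : nat) : Prop := MarkedCell {
  cell_inj : injective e;
  cell_size : forall c, size (e c) = m;
  cell_legal : forall c, legal theta (P ++ e c ++ Q);
  cell_exchange : forall c d l r,
    legal theta (l ++ (P ++ e c ++ Q) ++ r) -> legal theta (l ++ (P ++ e d ++ Q) ++ r);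
  cell_left : n <= size P;
  cell_right : n <= size Q;
  cell_marker : forall c d, 0 < d -> d + n <= size P + m + size Q ->
    take n (drop d (P ++ e c ++ Q)) <> take n P }.

(** Lets the [2 ^ t] available words outnumber the forbidden ones, whose number is linear in [t]. *)
Lemma linear_lt_exp2 a b : exists t, a * t + b < 2 ^ t.
Proof.
(* With this exponent [2 ^ t] is twice the square of [2 ^ (a + b)], hence at least
   [2 * (a + b).+1 ^ 2]. *)
exists ((a + b).*2 + 1); have := ltn_expl (a + b) (isT : 1 < 2).
rewrite addn1 expnS -muln2 expnM -mulnn; move: (2 ^ _) => z hz.
have : (a + b).+1 * (a + b).+1 <= z * z by exact: (leq_mul hz hz).
nia.
Qed.

Section Cells.
Variables (A : finType) (theta : rsubst A) (L : nat).
Hypothesis theta_len : constant_length theta L.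
Hypothesis theta_ok : is_random_subst theta.
Hypothesis theta_prim : primitive theta.
Hypothesis theta_nd : nondeterministic theta.
Hypothesis L2 : 1 < L.
Implicit Types (u v w l r : seq A) (a b : A).

(** After [p] steps a letter [a] with two images occurs below [b]. One more step chooses either
    image of [a] and fixes all other choices; equal lengths keep the two results distinct. *)
Lemma two_images : exists P, 0 < P /\ forall b, exists e : bool -> seq A,
  injective e /\ forall c, subst_iter theta P [:: b] (e c).
Proof.
have [a ha] := theta_nd; have [p [p0 hp]] := theta_prim.
exists p.+1; split=> // b; have [w [hw /splitPr s]] := hp a b; case: s hw => l r hw.
have [v0 [v1 [h0 h1 v01]]] : exists v0 v1, [/\ v0 \in theta a, v1 \in theta a & v0 != v1].
  case e: (undup _) ha => [|v0 [|v1 s]] //= _; exists v0, v1.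
  rewrite -!(mem_undup (theta a)) e !inE !eqxx orbT; split=> //.
  by have := undup_uniq (theta a); rewrite e /= inE negb_or -andbA => /andP[].
have [wl hl] := subst_iter_ex theta_ok 1 l; have [wr hr] := subst_iter_ex theta_ok 1 r.
exists (fun c : bool => wl ++ (if c then v0 else v1) ++ wr); split=> [c d|c].
  move/eqP; rewrite eqseq_cat // eqxx eqseq_cat /=; last first.
    by case: c d => [] [] //; rewrite (theta_len h0) (theta_len h1).
  by case: c d => [] [] //; rewrite 1?[v1 == _]eq_sym (negbTE v01).
exists (l ++ a :: r); split=> //; move: hl hr => /= [_ [-> hl]] [_ [-> hr]].
apply/subst_word_cat; exists wl, ((if c then v0 else v1) ++ wr); split=> //=.
by exists (if c then v0 else v1), wr; split=> //; case: c.
Qed.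

(** A level-[P] image of [b] has at least two letters, and each of the first two contributes an
    independent bit at the next [P] steps. *)
Lemma four_images : exists P, forall b, exists e : bool * bool -> seq A,
  injective e /\ forall c, subst_iter theta P [:: b] (e c).
Proof.
have [P [P0 two]] := two_images; exists (P + P) => b.
have [w hw] := subst_iter_ex theta_ok P [:: b].
have sw := size_subst_iter theta_len hw; have LP := ltn_expl P L2.
case: w hw sw => [|b1 [|b2 w]] hw sw; rewrite /= in sw; try lia.
have [e1 [i1 h1]] := two b1; have [e2 [i2 h2]] := two b2.
have [z hz] := subst_iter_ex theta_ok P w.
exists (fun c => e1 c.1 ++ e2 c.2 ++ z); split=> [[c1 c2] [d1 d2]|c].
  move/eqP; rewrite eqseq_cat ?(size_subst_iter theta_len (h1 _)) //.
  rewrite eqseq_cat ?(size_subst_iter theta_len (h2 _)) //=.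
  by case/and3P=> /eqP/i1-> /eqP/i2-> _.
apply/subst_iter_add; exists (b1 :: b2 :: w); split=> //.
rewrite -cat1s; apply/subst_iter_cat; exists (e1 c.1), (e2 c.2 ++ z); split=> //.
by rewrite -(cat1s b2); apply/subst_iter_cat; exists (e2 c.2), z.
Qed.

(** By constant length the image of the letter at index [j] is a block at a known position, and it
    may be exchanged for any other image of that letter. *)
Lemma subst_iter_nth p v w j : subst_iter theta p v w -> j < size v ->
  exists b w1 wb w2, [/\ w = w1 ++ wb ++ w2, size w1 = j * L ^ p,
    subst_iter theta p [:: b] wb &
    forall z, subst_iter theta p [:: b] z -> subst_iter theta p v (w1 ++ z ++ w2)].
Proof.
move=> hw hj; have [a0 _] := theta_nd.
have ev : v = take j v ++ [:: nth a0 v j] ++ drop j.+1 v by rewrite cat1s -drop_nth ?cat_take_drop.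
move: hw; rewrite {1}ev => /subst_iter_cat[w1 [w' [h1 /subst_iter_cat[wb [w2 [hb h2 ->]]] ->]]].
exists (nth a0 v j), w1, wb, w2; split=> //.
  by rewrite (size_subst_iter theta_len h1) size_takel // ltnW.
move=> z hz; rewrite ev; apply/subst_iter_cat; exists w1, (z ++ w2); split=> //.
by apply/subst_iter_cat; exists z, w2.
Qed.

(** A legal filler of length [2 * L ^ P] contains a complete level-[P] block wherever it is cut, and
    that block has four variants. *)
Lemma four_fillers : exists m, forall l s r, size s = m -> legal theta (l ++ s ++ r) ->
  exists e : bool * bool -> seq A,
    injective e /\ forall c, size (e c) = m /\ legal theta (l ++ e c ++ r).
Proof.
have [P four] := four_images; have [B eB] : exists B, B = L ^ P by eexists.
have B0 : 0 < B by rewrite eB expn_gt0 (ltnW L2).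
exists (B + B) => l s r ss [a [k [w [hw /infixP[l' [r' ew]]]]]].
(* A word of length [L ^ k] with [k < P] is too short to contain [s]. *)
have kP : P <= k.
  have := size_subst_iter theta_len hw; rewrite ew !size_cat ss /= mul1n => h.
  by rewrite leqNgt; apply/negP => kP; have := leq_pexp2l (ltnW L2) (ltnW kP); rewrite -eB; lia.
move: hw; rewrite -(subnK kP) => /subst_iter_add[v [hv hw]].
have [[L0 eL] [R0 eR]] : (exists x : seq A, x = l' ++ l) /\ exists y : seq A, y = r ++ r' by split; eexists.
have {}ew : w = L0 ++ s ++ R0 by rewrite ew eL eR -!catA.
(* [j * B] is the first block boundary strictly after position [size L0], so block [j] ends within
   [s]. *)
have [j [j1 j2]] : exists j, size L0 <= j * B /\ j * B <= size L0 + B.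
  exists (size L0 %/ B).+1; split; first by rewrite ltnW // -ltn_divLR.
  by rewrite mulSn addnC leq_add2r leq_divM.
have sw := size_subst_iter theta_len hw; rewrite -eB ew !size_cat ss in sw.
have jv : j < size v by rewrite -(ltn_pmul2r B0) -sw; apply: leq_ltn_trans j2 _; lia.
have [b [w1 [wb [w2 [ew2 s1 hb hz]]]]] := subst_iter_nth hw jv; rewrite -eB in s1.
have [e [ie he]] := four b.
have sb x : subst_iter theta P [:: b] x -> size x = B.
  by move/(size_subst_iter theta_len); rewrite mul1n eB.
have [x [y [e1 e2]]] : exists x y, w1 = L0 ++ x /\ w2 = y ++ R0.
  exists (drop (size L0) w1), (take (size w2 - size R0) w2); split.
    rewrite -{1}(cat_take_drop (size L0) w1); congr (_ ++ _).
    rewrite -(@takel_cat _ _ _ (wb ++ w2)); last by rewrite s1.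
    by rewrite -ew2 ew take_size_cat.
  rewrite -{1}(cat_take_drop (size w2 - size R0) w2); congr (_ ++ _).
  have e3 : (w1 ++ wb) ++ w2 = (L0 ++ s) ++ R0 by rewrite -!catA -ew2 ew.
  have := congr1 size e3; rewrite !size_cat s1 ss (sb _ hb) => s3.
  have := congr1 (drop (size (L0 ++ s))) e3; rewrite [in RHS]drop_size_cat //.
  rewrite drop_cat !size_cat s1 ss (sb _ hb) ltnNge.
  have -> /= : j * B + B <= size L0 + (B + B) by lia.
  by move=> {2}<-; congr (drop _ w2); lia.
have xy : size x + B + size y = B + B.
  have := congr1 size ew2; rewrite ew e1 e2 !size_cat ss (sb _ hb); lia.
exists (fun c => x ++ e c ++ y); split=> [c d /eqP|c].
  rewrite eqseq_cat // eqxx eqseq_cat ?(sb _ (he _)) //= eqxx andbT.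
  by move/eqP/ie.
split; first by rewrite !size_cat (sb _ (he c)); lia.
apply: (@legal_cat3 _ _ l' _ r').
exists a, k, (w1 ++ e c ++ w2); split.
  by rewrite -(subnK kP); apply/subst_iter_add; exists v; split=> //; apply: hz.
by rewrite e1 e2 eL eR -!catA infix_refl.
Qed.

Lemma exchangeable_fillers : exists p q (e : bool * bool -> seq A) m,
  [/\ injective e, forall c, size (e c) = m, forall c, legal theta (p ++ e c ++ q) &
     forall c d l r, legal theta (l ++ (p ++ e c ++ q) ++ r) ->
       legal theta (l ++ (p ++ e d ++ q) ++ r)].
Proof.
have [m four] := four_fillers.
(* Fillers of length [m] as tuples form a finite set, so they can be counted. *)
pose F p q : {set m.-tuple A} := [set s : m.-tuple A | `[< legal theta (p ++ s ++ q) >]].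
have inF p q (s : m.-tuple A) : s \in F p q <-> legal theta (p ++ s ++ q).
  by rewrite inE; split=> /asboolP.
have Fsub p q l r : F (l ++ p) (q ++ r) \subset F p q.
  apply/subsetP => s /inF; rewrite -!catA => h; apply/inF.
  by apply: (@legal_cat3 _ _ l _ r); rewrite -!catA.
have [p [q [F0 Fmin]]] : exists p q, F p q != set0 /\
    forall l r, F (l ++ p) (q ++ r) != set0 -> F (l ++ p) (q ++ r) = F p q.
  (* Descent on the number of fillers: an extension that keeps some filler but loses another has
     strictly fewer. *)
  suff H k : forall p q, F p q != set0 -> #|F p q| <= k -> exists p q, F p q != set0 /\
      forall l r, F (l ++ p) (q ++ r) != set0 -> F (l ++ p) (q ++ r) = F p q.
    have [a _] := theta_nd.
    have [u [su hu]] := legal_length theta_len theta_ok L2 a m.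
    apply: (H _ [::] [::] _ (leqnn _)); apply/set0Pn; exists (tcast su (in_tuple u)).
    by apply/inF; rewrite val_tcast cats0.
  elim: k => [|k IH] p q F0 Fk; first by move: F0; rewrite -card_gt0; lia.
  have [[l [r [n0 ne]]]|no] :=
      EM (exists l r, F (l ++ p) (q ++ r) != set0 /\ F (l ++ p) (q ++ r) <> F p q).
    apply: (IH _ _ n0); rewrite -ltnS; apply: leq_trans Fk; apply: proper_card.
    by rewrite properEneq Fsub andbT; apply/eqP.
  exists p, q; split=> // l r n0; apply: contrapT => ne.
  by apply: no; exists l, r.
have [s0 /inF s0F] := set0Pn _ F0.
have [e [ie he]] := four _ _ _ (size_tuple s0) s0F.
exists p, q, e, m; split=> // [c|c|c d l r]; [exact: (he c).1|exact: (he c).2|].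
have [/eqP sc hc] := he c; have [/eqP sd hd] := he d.
move=> h; have cF : Tuple sc \in F (l ++ p) (q ++ r) by apply/inF; move: h; rewrite -!catA.
have /inF : Tuple sd \in F (l ++ p) (q ++ r).
  by rewrite Fmin; [apply/inF | apply/set0Pn; exists (Tuple sc)].
by rewrite -!catA.
Qed.

(** Choosing one of two level-[P] images for each of the [t] letters of a legal word gives [2 ^ t]
    distinct legal words of the same length, too many to lie all in [Ks]. *)
Lemma legal_avoiding : exists B, 0 < B /\ forall t (Ks : seq (seq A)), size Ks < 2 ^ t ->
  exists Z, [/\ size Z = t * B, legal theta Z & Z \notin Ks].
Proof.
have [P [P0 two]] := two_images; pose B := L ^ P.
exists B; split=> [|t Ks hK]; first by rewrite expn_gt0 (ltnW L2).
have [a _] := theta_nd; have [v [sv hv]] := legal_length theta_len theta_ok L2 a t.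
have [ws [uw hw sw]] : exists ws, [/\ uniq ws, forall w, w \in ws -> subst_iter theta P v w
    & size ws = 2 ^ size v].
  elim: v {sv hv} => [|b v [ws [uw hw sw]]].
    by exists [:: [::]]; split=> // w; rewrite inE => /eqP->; apply/subst_iter_nil.
  have [e [ie he]] := two b.
  exists [seq x ++ y | x <- [:: e true; e false], y <- ws]; split.
  - apply: allpairs_uniq => //; first by rewrite /= inE andbT; apply/eqP => /ie.
    have se x : x \in [:: e true; e false] -> size x = B.
      by rewrite !inE => /orP[] /eqP->; rewrite (size_subst_iter theta_len (he _)) mul1n.
    move=> p p' /allpairsP[[x y] [hx _ ->]] /allpairsP[[x' y'] [hx' _ ->]] /= /eqP.
    by rewrite eqseq_cat ?(se _ hx) ?(se _ hx') // => /andP[/eqP-> /eqP->].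
  - move=> w /allpairsP[[x y] /= [hx /hw hy ->]].
    rewrite -cat1s; apply/subst_iter_cat; exists x, y; split=> //.
    by move: hx; rewrite !inE => /orP[] /eqP->.
  - by rewrite size_allpairs sw expnS.
have [Z hZ nZ] : exists2 Z, Z \in ws & Z \notin Ks.
  apply/hasP; rewrite has_predC; apply/negP => /allP sub.
  by have := uniq_leq_size uw sub; rewrite sw sv leqNgt hK.
exists Z; split=> //; first by rewrite (size_subst_iter theta_len (hw _ hZ)) sv.
by apply: (subst_iter_legal theta_ok hv); apply: hw hZ.
Qed.

(** The marker is a legal word [Z] of length [n] absent from every variant [h c] of the exchangeable
    word with margins of length [n]. Connecting [Z] to [h c] from the left yields the cell. *)
Lemma marked_cell_ex : exists P Q e m n, marked_cell theta P Q e m n.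
Proof.
have [p [q [e [m [ie se le ee]]]]] := exchangeable_fillers.
have [B [B0 avoid]] := legal_avoiding.
pose l0 := size p + m + size q.
(* The bound is the size of [Ks]: four data times [2 * n + l0 + 1] offsets, with [n = t * B]. *)
have [t ht] := linear_lt_exp2 (4 * (2 * B)) (4 * l0.+1).
pose n := t * B.
have [l [r [sl sr hlr]]] := legal_extend theta_len theta_ok theta_prim L2 n (le (true, true)).
pose h c := l ++ (p ++ e c ++ q) ++ r.
have sh c : size (h c) = 2 * n + l0 by rewrite /h !size_cat se sl sr /l0; lia.
pose Ks := [seq take n (drop d (h c)) | c <- enum {: bool * bool}, d <- iota 0 (2 * n + l0).+1].
have [|Z [sZ lZ ZK]] := avoid t Ks.
  rewrite size_allpairs size_iota -cardT card_prod card_bool.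
  by apply: leq_ltn_trans ht; rewrite /n; lia.
rewrite -/n in sZ.
have hZ c d : d <= 2 * n + l0 -> take n (drop d (h c)) <> Z.
  move=> hd E; case/negP: ZK; apply/allpairsP; exists (c, d).
  by rewrite mem_enum mem_iota.
have hle c : legal theta (h c) by apply: ee hlr.
(* Starting the cell at the last occurrence of Z before h makes Z occur in it only once. *)
have [g hg] := legal_transitive theta_len theta_ok theta_prim L2 lZ hlr.
have [G eG] : exists G : seq A, G = Z ++ g by eexists.
(* An occurrence of length [n] starting no later than the end of [G] ends within [l], so it can be
   tested without the data [c]. *)
pose occ d := (d <= size G) && (take n (drop d (G ++ l)) == Z).
have occ0 : occ 0 by rewrite /occ drop0 eG -catA take_size_cat ?eqxx.
have occb d : occ d -> d <= size G by case/andP.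
case: (ex_maxnP (ex_intro _ 0 occ0) occb) => d0 /andP[d0G /eqP d0Z] d0max.
pose P := drop d0 (G ++ l) ++ p; pose Q := q ++ r.
have wE c : P ++ e c ++ Q = drop d0 (G ++ h c).
  rewrite /P /Q /h -!catA [in RHS]catA [in RHS]drop_cat size_cat sl.
  case: ltnP => // h1; rewrite (_ : d0 = size G + n) ?subnn ?drop0 ?drop_oversize ?size_cat ?sl //.
  lia.
have nP : n <= size (drop d0 (G ++ l)) by rewrite size_drop size_cat sl; lia.
have PZ : take n P = Z by rewrite takel_cat.
have lGh c : legal theta (G ++ h c).
  have := @ee (true, true) c (G ++ l) r; rewrite eG -!catA; apply.
  by move: hg; rewrite /h -!catA.
exists P, Q, e, m, n; split=> // [c|c d l' r'|||c d d_gt0 dn].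
- by apply: legal_infix (lGh c) _; rewrite wE; apply: infix_drop.
- rewrite /P /Q -!catA => H; rewrite !catA -(catA _ q); rewrite -!catA.
  have := ee c d (l' ++ drop d0 (G ++ l)) (r ++ r'); rewrite -!catA; exact.
- by rewrite size_cat; lia.
- by rewrite size_cat; lia.
rewrite PZ wE drop_drop => E.
have sP : size P + m + size Q = size G + 2 * n + l0 - d0.
  by have := congr1 size (wE c); rewrite size_drop [size (G ++ _)]size_cat sh [size (P ++ _)]size_cat [size (e c ++ _)]size_cat se; lia.
(* A second marker would start either inside [h c], which avoids [Z], or before it, against the
   maximality of [d0]. *)
have [hd|hd] := leqP (size G) (d + d0).
  move: E; rewrite drop_cat ltnNge hd /=; apply: hZ; lia.
suff /d0max : occ (d + d0) by lia.
rewrite /occ ltnW //= -E; apply/eqP.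
rewrite [in RHS]/h catA [in RHS]drop_cat size_cat sl ifT; last by lia.
by rewrite takel_cat // size_drop size_cat sl; lia.
Qed.

End Cells.

Import Order.TTheory GRing.Theory Num.Theory.
Local Open Scope ring_scope.

(** * Cells of a configuration *)

Section Configs.
Variable B : Type.
Implicit Types (x y : config B) (i : int).

Definition window x i n : seq B := [seq x (i + k%:Z) | k <- iota 0 n].

Lemma size_window x i n : size (window x i n) = n.
Proof. by rewrite size_map size_iota. Qed.

Lemma nth_window b x i n k : (k < n)%N -> nth b (window x i n) k = x (i + k%:Z).
Proof. by move=> kn; rewrite (nth_map 0%N) ?size_iota // nth_iota. Qed.

Lemma window_shift x i n : window (shift x) i n = window x (i + 1) n.
Proof. by apply: eq_map => k; rewrite /shift addrAC. Qed.

Lemma window_add x i n1 n2 : window x i (n1 + n2) = window x i n1 ++ window x (i + n1%:Z) n2.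
Proof.
rewrite /window iotaD map_cat add0n -{2}(addn0 n1) iotaDl -map_comp; congr (_ ++ _).
by apply: eq_map => k /=; rewrite PoszD addrA.
Qed.

Lemma eq_window x y i n : (forall k : int, i <= k < i + n%:Z -> x k = y k) -> window x i n = window y i n.
Proof. by move=> h; apply/eq_in_map => k; rewrite mem_iota => hk; apply: h; lia. Qed.

Lemma window_eqP b x i n (w : seq B) : size w = n ->
  (forall k, (k < n)%N -> x (i + k%:Z) = nth b w k) <-> window x i n = w.
Proof.
move=> sw; split=> [h|<- k kn]; last by rewrite nth_window.
by apply: (@eq_from_nth _ b); rewrite size_window // => k kn; rewrite nth_window ?h.
Qed.

Lemma window_sub x i n d n' : (d + n' <= n)%N ->
  window x (i + d%:Z) n' = take n' (drop d (window x i n)).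
Proof.
move=> dn; have -> : n = (d + (n' + (n - d - n')))%N by lia.
rewrite !window_add drop_size_cat ?size_window // take_size_cat ?size_window //.
Qed.

End Configs.

(** * Rewriting the data stored in the cells of a configuration *)

Section CellUpdate.
Variables (A : finType) (theta : rsubst A) (P Q : seq A) (e : bool * bool -> seq A) (m n : nat).
Hypothesis mc : marked_cell theta P Q e m n.
Implicit Types (x y : config A) (i j : int) (D : int -> bool * bool).

Definition pattern c := P ++ e c ++ Q.
Definition pattern_size := (size P + m + size Q)%N.
Definition is_cell x i := [exists c, window x i pattern_size == pattern c].
Definition cell_data x i := odflt (true, true) [pick c | window x i pattern_size == pattern c].
(** The coordinate [k] is at offset [o] in the filler of the cell starting at [k - size P - o].
    Fillers are disjoint, so at most one [o] qualifies; the default [x k] of [nth] is never reached,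
    as fillers have length [m]. *)
Definition update x D : config A := fun k =>
  if [pick o : 'I_m | is_cell x (k - (size P)%:Z - (o : nat)%:Z)] is Some o
  then nth (x k) (e (D (k - (size P)%:Z - (o : nat)%:Z))) o else x k.

Lemma size_pattern c : size (pattern c) = pattern_size.
Proof. by rewrite !size_cat (cell_size mc) addnA. Qed.

Lemma is_cellP x i : reflect (exists c, window x i pattern_size = pattern c) (is_cell x i).
Proof. by apply: (iffP existsP) => -[c /eqP h]; exists c => //; apply/eqP. Qed.

Lemma pattern_inj : injective pattern.
Proof.
move=> c d /eqP; rewrite eqseq_cat // eqxx eqseq_cat ?(cell_size mc) //=.
by case/andP=> /eqP/(cell_inj mc).
Qed.

Lemma window_cell x i : is_cell x i -> window x i pattern_size = pattern (cell_data x i).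
Proof.
move=> /is_cellP[c h]; rewrite /cell_data; case: pickP => [d /eqP //|/(_ c)].
by rewrite h eqxx.
Qed.

Lemma cell_dataE x i c : window x i pattern_size = pattern c -> cell_data x i = c.
Proof.
move=> h; apply: pattern_inj; rewrite -h [RHS]window_cell //.
by apply/is_cellP; exists c.
Qed.

(** The pattern at [j] begins with the marker, which does not recur in the pattern at [i], so
    [j - i] exceeds the pattern size minus [n]. As both [P] and [Q] have length at least [n],
    neither pattern meets the filler of the other. *)
Lemma cells_apart_lt x i j : is_cell x i -> is_cell x j -> i < j ->
  (size P + m)%:Z <= j - i /\ (m + size Q)%:Z <= j - i.
Proof.
move=> /is_cellP[c hc] /is_cellP[d hd] ij.
have nP := cell_left mc; have nQ := cell_right mc.
have [k [ek k0]] : exists k : nat, j = i + k%:Z /\ (0 < k)%N.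
  by exists `|j - i|%N; lia.
suff : (pattern_size < k + n)%N by rewrite /pattern_size; lia.
rewrite ltnNge; apply/negP => kn.
case: (cell_marker mc (c := c) k0 kn).
rewrite -/(pattern c) -hc -window_sub // -ek -[window x j n]/(window x j n).
have := @window_sub _ x j pattern_size 0 n; rewrite addr0 drop0 => ->; last by rewrite /pattern_size; lia.
by rewrite hd takel_cat.
Qed.

Lemma cells_apart x i j : is_cell x i -> is_cell x j -> i != j ->
  (size P + m)%:Z <= `|j - i| /\ (m + size Q)%:Z <= `|j - i|.
Proof.
move=> hi hj ij; have [lt|lt] : i < j \/ j < i by lia.
  by have := cells_apart_lt hi hj lt; lia.
by have := cells_apart_lt hj hi lt; lia.
Qed.

Lemma update_in x D i o b : is_cell x i -> (o < m)%N ->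
  update x D (i + (size P)%:Z + o%:Z) = nth b (e (D i)) o.
Proof.
move=> hi om; rewrite /update; case: pickP => [o'|/(_ (Ordinal om))] /=.
  have [j ej] : exists j, j = i + (size P)%:Z + o%:Z - (size P)%:Z - (o' : nat)%:Z by eexists.
  rewrite -ej => hj; have := ltn_ord o'.
  have [ij|ij] := eqVneq i j; last by have := cells_apart hi hj ij; lia.
  have <- : o = o' by lia.
  by move=> _; rewrite -ij; apply: set_nth_default; rewrite (cell_size mc).
have -> : i + (size P)%:Z + o%:Z - (size P)%:Z - o%:Z = i by lia.
by rewrite hi.
Qed.

Lemma update_out x D (k : int) :
  (forall i, is_cell x i -> ~ (i + (size P)%:Z <= k < i + (size P + m)%:Z)) -> update x D k = x k.
Proof.
move=> h; rewrite /update; case: pickP => // o /h []; have := ltn_ord o; lia.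
Qed.

Lemma update_out_cell x D i (k : int) : is_cell x i -> i <= k < i + pattern_size%:Z ->
  ~ (i + (size P)%:Z <= k < i + (size P + m)%:Z) -> update x D k = x k.
Proof.
rewrite /pattern_size => hi hk nk; apply: update_out => j hj.
have [<- //|ij] := eqVneq i j; have := cells_apart hi hj ij; lia.
Qed.

Lemma window_update x D i : is_cell x i -> window (update x D) i pattern_size = pattern (D i).
Proof.
move=> hi; have hw := window_cell hi.
have c0 := x 0.
apply/(window_eqP c0); rewrite ?size_pattern // => k hk.
have /(window_eqP c0) hx : window x i pattern_size = pattern (cell_data x i) by [].
have [k1|k1] := ltnP k (size P).
  rewrite (@update_out_cell x D i) ?hx ?size_pattern //; try lia.
  by rewrite !nth_cat k1.
have [k2|k2] := ltnP k (size P + m).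
  have -> : i + k%:Z = i + (size P)%:Z + (k - size P)%N%:Z by lia.
  rewrite (update_in _ c0) //; last by lia.
  by rewrite !nth_cat ltnNge k1 /= (cell_size mc) ifT //; lia.
rewrite (@update_out_cell x D i) ?hx ?size_pattern //; try lia.
have km : (k - size P < m)%N = false by lia.
by rewrite !nth_cat ltnNge k1 /= !(cell_size mc) km.
Qed.

Lemma is_cell_update x D i : is_cell (update x D) i = is_cell x i.
Proof.
have up j : is_cell x j -> is_cell (update x D) j.
  by move=> hj; apply/is_cellP; exists (D j); apply: window_update.
apply/idP/idP => [hi|]; last exact: up.
(* A newly created cell would, inside the updated configuration, be kept off the fillers of the old
   cells, hence lie where nothing changed. *)
apply: contraT => ni; case/negP: (ni); move/is_cellP: (hi) => [c hc].
apply/is_cellP; exists c; rewrite -hc; apply: eq_window => k hk.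
apply/esym/update_out => j hj jk.
have ij : i != j by apply: contraNneq ni => ->.
have := cells_apart hi (up _ hj) ij; move: hk; rewrite /pattern_size; lia.
Qed.

Lemma cell_data_update x D i : is_cell x i -> cell_data (update x D) i = D i.
Proof. by move=> hi; apply: cell_dataE; apply: window_update. Qed.

Lemma eq_update x D D' : (forall i, is_cell x i -> D i = D' i) -> update x D = update x D'.
Proof. by move=> h; apply/funext => k; rewrite /update; case: pickP => // o /h ->. Qed.

Lemma in_cellP x (k : int) : (exists i (o : nat), [/\ is_cell x i, (o < m)%N & k = i + (size P)%:Z + o%:Z]) \/
  (forall i, is_cell x i -> ~ (i + (size P)%:Z <= k < i + (size P + m)%:Z)).
Proof.
have [[i [hi ki]]|no] :=
    EM (exists i, is_cell x i /\ (i + (size P)%:Z <= k < i + (size P + m)%:Z)).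
  by left; exists i, (absz (k - i - (size P)%:Z)%R); split=> //; lia.
by right=> i hi ki; apply: no; exists i.
Qed.

Lemma update_update x D D' : update (update x D) D' = update x D'.
Proof.
apply/funext => k; have [[i [o [hi om ->]]]|no] := in_cellP x k.
  by rewrite !(update_in _ (x k)) // is_cell_update.
rewrite !update_out // => i; rewrite is_cell_update; exact: no.
Qed.

Lemma update_cell_data x : update x (cell_data x) = x.
Proof.
apply/funext => k; have [[i [o [hi om ->]]]|no] := in_cellP x k; last by rewrite update_out.
rewrite (update_in _ (x k)) //; have /(window_eqP (x k)) := window_cell hi.
rewrite size_pattern => /(_ erefl (size P + o)%N); rewrite PoszD addrA => ->.
  by rewrite !nth_cat ltnNge leq_addr addKn (cell_size mc) om.
by rewrite /pattern_size; lia.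
Qed.

Lemma is_cell_local x y i : (forall k : int, i <= k < i + pattern_size%:Z -> x k = y k) ->
  is_cell x i = is_cell y i /\ cell_data x i = cell_data y i.
Proof. by move/eq_window => h; rewrite /is_cell /cell_data h. Qed.

Lemma update_local x y D D' (k : int) :
  (forall j, k - pattern_size%:Z <= j <= k + pattern_size%:Z -> x j = y j) ->
  (forall i, k - pattern_size%:Z <= i <= k -> is_cell x i -> D i = D' i) ->
  update x D k = update y D' k.
Proof.
move=> xy DD; have xyc i : k - pattern_size%:Z <= i <= k -> is_cell x i = is_cell y i.
  by move=> hi; apply: (is_cell_local _).1 => j hj; apply: xy; lia.
have [[i [o [hi om ek]]]|no] := in_cellP x k.
  have ik : k - pattern_size%:Z <= i <= k by rewrite /pattern_size; lia.
  by rewrite ek !(update_in _ (x k)) -?xyc // DD.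
rewrite !update_out //; first by apply: xy; lia.
move=> i hi ik; apply: (no i) => //; rewrite xyc //.
by rewrite /pattern_size; lia.
Qed.

Lemma is_cell_shift x i : is_cell (shift x) i = is_cell x (i + 1).
Proof. by rewrite /is_cell window_shift. Qed.

Lemma cell_data_shift x i : cell_data (shift x) i = cell_data x (i + 1).
Proof. by rewrite /cell_data window_shift. Qed.

Lemma update_shift x D D' : (forall i, D i = D' (i + 1)) ->
  update (shift x) D = shift (update x D').
Proof.
move=> DD; apply/funext => k; rewrite /update /shift.
rewrite (eq_pick (Q := fun o : 'I_m => is_cell x (k + 1 - (size P)%:Z - (o : nat)%:Z))).
  case: pickP => // o _; rewrite DD; congr (nth _ (e (D' _)) _); lia.
by move=> o /=; rewrite is_cell_shift; congr is_cell; lia.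
Qed.

(** Any window can be enlarged to contain the whole cell at [j], where exchangeability applies. *)
Lemma X_update1 x D j : X_theta theta x -> is_cell x j ->
  (forall i, is_cell x i -> i != j -> D i = cell_data x i) -> X_theta theta (update x D).
Proof.
move=> Xx hj hD i N.
have yx (k : int) : ~ (j + (size P)%:Z <= k < j + (size P + m)%:Z) -> update x D k = x k.
  have [[i' [o [hi' om ek]]]|no] := in_cellP x k; last by rewrite update_out.
  move=> nk; have ij : i' != j by apply: contra_notN nk => /eqP <-; lia.
  rewrite -{2}(update_cell_data x) ek !(update_in _ (x k)) ?hD //.
(* An origin to the left of both the window and the cell turns all positions into natural
   offsets. *)
have [i1 [h1 h2]] : exists i1, i1 <= i /\ i1 <= j by exists (i - `|j - i|); lia.
have [a [b [N2 [ea ej eb]]]] : exists a b N2 : nat, [/\ i = i1 + a%:Z, j = i1 + b%:Z &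
    (a + N <= b + pattern_size + N2)%N].
  by exists (absz (i - i1)%R), (absz (j - i1)%R), (absz (i - i1)%R + N)%N; split; lia.
have legal_sub z (d k : nat) (M : nat) : (d + k <= M)%N -> legal theta (window z i1 M) ->
    legal theta (window z (i1 + d%:Z) k).
  move=> dk hz; rewrite (window_sub _ _ dk); apply: legal_infix hz _.
  by apply: infix_trans (infix_take _ _) (infix_drop _ _).
rewrite -/(window _ i N) ea; apply: legal_sub eb _; rewrite -addnA 2!window_add -ej.
rewrite (window_update D hj).
have -> : window (update x D) i1 b = window x i1 b.
  by apply: eq_window => k hk; apply: yx; lia.
have -> : window (update x D) (j + pattern_size%:Z) N2 = window x (j + pattern_size%:Z) N2.
  by apply: eq_window => k; rewrite /pattern_size => hk; apply: yx; lia.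
apply: (cell_exchange mc (c := cell_data x j)); rewrite -/(pattern _) -window_cell //.
by have := Xx i1 (b + (pattern_size + N2))%N; rewrite -/(window _ _ _) 2!window_add -ej.
Qed.

(** A window meets only finitely many cells, and these can be changed one at a time. *)
Lemma X_update x D : X_theta theta x -> X_theta theta (update x D).
Proof.
move=> Xx i N.
pose Ds (s : seq int) k := if k \in s then D k else cell_data x k.
have XDs s : X_theta theta (update x (Ds s)).
  elim: s => [|j s IH]; first by rewrite (_ : Ds [::] = cell_data x) ?update_cell_data.
  have [hj|nj] := boolP (is_cell x j); last first.
    rewrite (eq_update (D' := Ds s)) // => k hk; rewrite /Ds inE.
    by case: eqVneq hk => // ->; rewrite (negbTE nj).
  rewrite -(update_update x (Ds s)).
  apply: (X_update1 IH (j := j)); first by rewrite is_cell_update.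
  move=> k; rewrite is_cell_update => hk kj.
  by rewrite cell_data_update // /Ds inE (negbTE kj).
(* All starting positions of cells that can affect a coordinate of the window. *)
pose s := [seq i - pattern_size%:Z + k%:Z | k <- iota 0 (N + pattern_size).+1].
have := XDs s i N; congr legal; apply/eq_in_map => k; rewrite mem_iota => hk.
apply: update_local => // j hj _; rewrite /Ds ifT //.
by apply/mapP; exists (absz (j - (i - pattern_size%:Z))%R); rewrite ?mem_iota; lia.
Qed.

End CellUpdate.

(** * Configurations containing given legal words *)

Section Configurations.
Variables (A : finType) (theta : rsubst A) (L : nat).
Hypothesis theta_len : constant_length theta L.
Hypothesis theta_ok : is_random_subst theta.
Hypothesis theta_prim : primitive theta.
Hypothesis L2 : (1 < L)%N.

Lemma legal_config w : legal theta w -> exists x, X_theta theta x /\ window x 0 (size w) = w.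
Proof.
move=> lw; have [a _] := lw.
have /choice[f hf] u : exists lr : A * A, legal theta u -> legal theta (lr.1 :: u ++ [:: lr.2]).
  have [lu|nlu] := EM (legal theta u); last by exists (a, a).
  have [l [r [sl sr h]]] := legal_extend theta_len theta_ok theta_prim L2 1 lu.
  case: l r sl sr h => [|l []] //= [|r []] //= _ _ h; by exists (l, r).
pose W k := iter k (fun u => (f u).1 :: u ++ [:: (f u).2]) w.
have lW k : legal theta (W k) by elim: k => //= k /hf.
have sW k : size (W k) = (size w + k.*2)%N.
  by elim: k => [|k IH] /=; rewrite ?addn0 // size_cat /= -/(W k) IH; lia.
have W_add k d p : (p < size (W k))%N -> nth a (W (k + d)%N) (p + d) = nth a (W k) p.
  move=> pk; elim: d => [|d IH]; first by rewrite !addn0.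
  rewrite !addnS /= nth_cat -/(W (k + d)%N) ifT ?IH //; move: pk; rewrite !sW; lia.
(* [W k] is laid out from coordinate [-k], so [W (|i| + 1)] already covers [i], at index
   [i + |i| + 1]. *)
pose x (i : int) := nth a (W `|i|.+1) (absz (i + `|i|.+1%:Z)%R).
have xW k : window x (- k%:Z) (size (W k)) = W k.
  apply/(window_eqP a) => // p pk; rewrite /x; set i := - k%:Z + p%:Z.
  have [i' ei] : exists i', i' = i by eexists.
  rewrite -ei; have {}ei : i' = - k%:Z + p%:Z by [].
  have -> : absz (i' + `|i'|.+1%:Z)%R = (p + (`|i'|.+1) - k)%N by lia.
  have [ki|ki] := leqP k `|i'|.+1.
    by rewrite -(W_add k (`|i'|.+1 - k)%N p pk); congr (nth a (W _) _); lia.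
  rewrite -(W_add `|i'|.+1 (k - `|i'|.+1)%N); last by rewrite sW; move: pk; rewrite sW; lia.
  by congr (nth a (W _) _); lia.
exists x; split; last exact: (xW 0%N).
move=> i N; pose k := (absz i + N)%N.
have [d ed] : exists d : nat, i = - k%:Z + d%:Z by exists (absz (i + k%:Z)%R); rewrite /k; lia.
rewrite -/(window x i N) ed (@window_sub _ _ _ (size (W k))); last by rewrite sW; move: ed; rewrite /k; lia.
rewrite xW; apply: legal_infix (lW k) _.
by apply: infix_trans (infix_take _ _) (infix_drop _ _).
Qed.

(** Every letter has a level-[N0] image containing [u]; concatenating such images along a long legal
    word makes [u] recur with gaps that do not depend on [K]. *)
Lemma syndetic_config u : legal theta u -> exists R, forall K : nat, exists x,
  X_theta theta x /\ forall i : int, 0 <= i <= K%:Z ->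
    exists j, i < j <= i + R%:Z /\ window x j (size u) = u.
Proof.
move=> lu; have [N0 rN] := legal_realised theta_len theta_ok theta_prim L2 lu.
have {}rN := rN _ (leqnn N0); have [a _] := lu.
have [B eB] : exists B, B = (L ^ N0)%N by eexists.
have B0 : (0 < B)%N by rewrite eB expn_gt0 (ltnW L2).
(* The next block starts at most [B] after [i], and its copy of [u] at most [B] later. *)
exists (B + B)%N => K.
have [v [sv lv]] := legal_length theta_len theta_ok L2 a (K + 2).
have [w [hw occ]] : exists w, subst_iter theta N0 v w /\ forall s, (s < size v)%N ->
    exists o, ((o <= B) && (s * B + o + size u <= size w))%N /\ take (size u) (drop (s * B + o)%N w) = u.
  elim: v {sv lv} => [|b v [w [hw occ]]]; first by exists [::]; split=> //; apply/subst_iter_nil.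
  have [z [hz /infixP[l [r ez]]]] := rN b.
  have sz : size z = B by rewrite (size_subst_iter theta_len hz) mul1n eB.
  have [l' [r' {}ez]] : exists l' r' : seq A, z = l' ++ u ++ r' by exists l, r.
  have := congr1 size ez; rewrite sz !size_cat => sB.
  exists (z ++ w); split; first by rewrite -cat1s; apply/subst_iter_cat; exists z, w.
  case=> [_|s /= /occ[o [/andP[o1 o2] o3]]].
    exists (size l'); rewrite mul0n add0n size_cat sz; split; first by lia.
    by rewrite ez -!catA drop_size_cat // take_size_cat.
  exists o; rewrite size_cat sz o1 mulSn; split; first by lia.
  by rewrite -!addnA drop_cat sz ltnNge leq_addr /= addKn.
have [x [Xx xw]] := legal_config (subst_iter_legal theta_ok lv hw).
exists x; split=> // i hi; pose s := (absz i %/ B).+1.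
have s1 : (absz i < s * B)%N by rewrite -ltn_divLR.
have s2 : (s * B <= absz i + B)%N by rewrite mulSn addnC leq_add2r leq_divM.
have sv2 : (s < size v)%N.
  rewrite sv /s; have := leq_div (absz i) B; lia.
have [o [/andP[o1 o2] o3]] := occ _ sv2.
exists (s * B + o)%N%:Z; split; first by lia.
rewrite -[X in window _ X _]add0r (@window_sub _ _ _ (size w)) ?xw //.
Qed.

End Configurations.

(** * Conveyor belts *)

(** Turns knowledge of one coordinate along an equivariant family into knowledge of a whole
    configuration. *)
Lemma shift_orbit (B : Type) (h : int -> config B) :
  (forall z, h (z + 1) = shift (h z)) -> forall z w, h z w = h 0 (w + z).
Proof.
move=> hS; have hn (k : nat) z w : h (z + k%:Z) w = h z (w + k%:Z).
  elim: k z w => [|k IH] z w; first by rewrite !addr0.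
  have -> : z + k.+1%:Z = (z + 1) + k%:Z by lia.
  by rewrite IH hS /shift; congr (h z _); lia.
case=> k w; first by rewrite -(add0r (Posz k)) hn add0r.
(* A negative index is reached from itself: [k.+1] steps forward lead to 0. *)
have := hn k.+1 (Negz k) (w + Negz k).
have -> : Negz k + k.+1%:Z = 0 by lia.
by move=> ->; congr (h _ _); lia.
Qed.

Lemma finite_bound (T : eqType) (s : seq T) (P : T -> nat -> Prop) :
  (forall t a b, (a <= b)%N -> P t a -> P t b) ->
  (forall t, exists a, P t a) -> exists a, forall t, t \in s -> P t a.
Proof.
move=> mon ex; elim: s => [|t s [a ha]]; first by exists 0%N.
have [b hb] := ex t; exists (maxn a b) => t'; rewrite inE => /orP[/eqP->|/ha].
  by apply: mon hb; rewrite leq_maxr.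
by apply: mon; rewrite leq_maxl.
Qed.

(** A slot [(i, b)] is one bit of the cell at [i]: [true] is the upper row, travelled rightwards,
    and [false] the lower row, travelled leftwards. *)
Definition flip (t : int * bool) := (t.1, ~~ t.2).

Lemma flipK : involutive flip.
Proof. by case=> i b; rewrite /flip negbK. Qed.

Section Belt.
Variable R : nat.
Implicit Types (c : int -> bool) (i j : int) (t : int * bool).

Definition linked c i j := [&& c i, c j, i < j, j <= i + R%:Z &
  [forall k : 'I_R, (i + (k : nat).+1%:Z < j) ==> ~~ c (i + (k : nat).+1%:Z)]].

(** A cell has at most one linked neighbour on each side, so each [pick] has at most one
    candidate. *)
Definition belt_next c t : int * bool :=
  if t.2 then
    if [pick k : 'I_R | linked c t.1 (t.1 + (k : nat).+1%:Z)] is Some k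
    then (t.1 + (k : nat).+1%:Z, true) else (t.1, false)
  else
    if [pick k : 'I_R | linked c (t.1 - (k : nat).+1%:Z) t.1] is Some k
    then (t.1 - (k : nat).+1%:Z, false) else (t.1, true).

Definition belt_prev c t := flip (belt_next c (flip t)).

Definition belt_orbit c t (z : int) :=
  match z with Posz k => iter k (belt_next c) t | Negz k => iter k.+1 (belt_prev c) t end.

Lemma linkedP c i j : linked c i j <-> [/\ c i, c j, i < j <= i + R%:Z &
  forall k : int, i < k < j -> ~~ c k].
Proof.
split=> [/and5P[ci cj ij jR /forallP h]|[ci cj /andP[ij jR] h]].
  split=> // [|k hk]; first by rewrite ij.
  have kR : (absz (k - i - 1)%R < R)%N by lia.
  have := h (Ordinal kR); rewrite /=.
  have -> : i + (absz (k - i - 1)%R).+1%:Z = k by lia.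
  by move/implyP; apply; lia.
apply/and5P; split=> //; apply/forallP => k; apply/implyP => hk; apply: h; lia.
Qed.

Lemma linked_next c i j : linked c i j -> belt_next c (i, true) = (j, true).
Proof.
move=> h; have /linkedP[ci cj ij hk] := h; rewrite /belt_next /=.
case: pickP => [k /linkedP[_ ck _ hk']|no].
  have [lt|[lt|->]] : (i + k.+1%:Z < j) \/ (j < i + k.+1%:Z) \/ (i + k.+1%:Z = j) by lia.
  - by move: ck; rewrite (negbTE (hk _ _)) //; lia.
  - by move: cj; rewrite (negbTE (hk' _ _)) //; lia.
  - by [].
have kR : (absz (j - i - 1)%R < R)%N by lia.
have := no (Ordinal kR); rewrite /=.
have -> : i + (absz (j - i - 1)%R).+1%:Z = j by lia.
by rewrite h.
Qed.

Lemma linked_prev c i j : linked c i j -> belt_next c (j, false) = (i, false).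
Proof.
move=> h; have /linkedP[ci cj ij hk] := h; rewrite /belt_next /=.
case: pickP => [k /linkedP[ck _ _ hk']|no].
  have [lt|[lt|->]] : (j - k.+1%:Z < i) \/ (i < j - k.+1%:Z) \/ (j - k.+1%:Z = i) by lia.
  - by move: ci; rewrite (negbTE (hk' _ _)) //; lia.
  - by move: ck; rewrite (negbTE (hk _ _)) //; lia.
  - by [].
have kR : (absz (j - i - 1)%R < R)%N by lia.
have := no (Ordinal kR); rewrite /=.
have -> : j - (absz (j - i - 1)%R).+1%:Z = i by lia.
by rewrite h.
Qed.

Lemma belt_nextP c t : [\/ exists j, [/\ linked c t.1 j, t.2 & belt_next c t = (j, true)],
  exists j, [/\ linked c j t.1, ~~ t.2 & belt_next c t = (j, false)] |
  belt_next c t = flip t].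
Proof.
case: t => i [] /=.
  have [[j h]|no] := EM (exists j, linked c i j); [constructor 1|constructor 3].
    by exists j; rewrite (linked_next h).
  rewrite /belt_next /=; case: pickP => // k h; case: no; by eexists; exact: h.
have [[j h]|no] := EM (exists j, linked c j i); [constructor 2|constructor 3].
  by exists j; rewrite (linked_prev h).
rewrite /belt_next /=; case: pickP => // k h; case: no; by eexists; exact: h.
Qed.

(* Reversing the direction of travel conjugates [belt_next] to its inverse. *)
Lemma belt_next_flip c t : flip (belt_next c (flip (belt_next c t))) = t.
Proof.
have [[j [h tb e]]|[j [h tb e]]|e] := belt_nextP c t; rewrite e /flip /=.
- by rewrite (linked_prev h) /=; case: t tb {h e} => i [].
- by rewrite (linked_next h) /=; case: t tb {h e} => i [].
(* After a turn and a flip the slot [t] is stepped again; a moving step would keep the row, so it is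
   the same turn. *)
have [[j [h /= tb e']]|[j [h /= tb e']]|] := belt_nextP c t.
- by move: e'; rewrite e /flip; case: t tb {h e} => i [].
- by move: e'; rewrite e /flip; case: t tb {h e} => i [].
by rewrite negbK -surjective_pairing e /flip /= negbK -surjective_pairing.
Qed.

Lemma belt_nextK c : cancel (belt_next c) (belt_prev c).
Proof. exact: belt_next_flip. Qed.

Lemma belt_prevK c : cancel (belt_prev c) (belt_next c).
Proof. by move=> t; apply: (can_inj flipK); rewrite [flip (belt_next _ _)]belt_next_flip. Qed.

Lemma belt_orbitS c t z : belt_orbit c t (z + 1) = belt_next c (belt_orbit c t z).
Proof.
case: z => [k|[|k]]; first by rewrite -[_ + 1]PoszD addn1.
  by rewrite [LHS]/= belt_prevK.
have -> : Negz k.+1 + 1 = Negz k by lia.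
by rewrite [in RHS]/= belt_prevK.
Qed.

Lemma belt_orbit_next c t z : belt_orbit c (belt_next c t) z = belt_orbit c t (z + 1).
Proof.
case: z => [k|[|k]]; first by rewrite -[_ + 1]PoszD addn1 /= -iterSr.
  by rewrite /= belt_nextK.
have -> : Negz k.+1 + 1 = Negz k by lia.
by rewrite [LHS]/belt_orbit iterSr belt_nextK.
Qed.

Lemma belt_next_cell c t : c t.1 -> c (belt_next c t).1.
Proof. by move=> ct; case: (belt_nextP c t) => [[j [/linkedP[] ? ? _ _ _ ->]]|[j [/linkedP[] ? ? _ _ _ ->]]|->]. Qed.

Lemma belt_orbit_cell c t z : c t.1 -> c (belt_orbit c t z).1.
Proof.
move=> ct; case: z => k; rewrite /belt_orbit; last move: k.+1 => {}k.
  by elim: k => //= k; apply: belt_next_cell.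
by elim: k => //= k ck; apply: (@belt_next_cell _ (flip _)).
Qed.

Lemma belt_next_near c t : `|(belt_next c t).1 - t.1| <= R%:Z.
Proof.
case: (belt_nextP c t) => [[j [/linkedP[_ _ h _] _ ->]]|[j [/linkedP[_ _ h _] _ ->]]|->] /=; lia.
Qed.

Lemma linked_local c c' i j (K : nat) : (forall k : int, `|k| <= K%:Z -> c k = c' k) ->
  `|i| <= K%:Z -> `|j| <= K%:Z -> linked c i j = linked c' i j.
Proof.
move=> h hi hj; rewrite /linked !h //; congr [&& _, _, _, _ & _].
apply: eq_forallb => k; case: ltP => //= kj; rewrite h //; lia.
Qed.

Lemma belt_next_local c c' t (K : nat) : (forall k : int, `|k| <= K%:Z -> c k = c' k) ->
  `|t.1| + R%:Z <= K%:Z -> belt_next c t = belt_next c' t.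
Proof.
move=> h ht; rewrite /belt_next; case: ifP => _.
  by congr (if _ is Some k then _ else _); apply: eq_pick => k /=; apply: (linked_local h); have := ltn_ord k; lia.
by congr (if _ is Some k then _ else _); apply: eq_pick => k /=; apply: (linked_local h); have := ltn_ord k; lia.
Qed.

(** Each step moves by at most [R] and inspects cells no further away than [R], so a margin of
    [M.+1 * R] suffices for [M] steps in either direction. *)
Lemma belt_orbit_local c c' t (K M : nat) : (forall k : int, `|k| <= K%:Z -> c k = c' k) ->
  `|t.1| + (M.+1 * R)%N%:Z <= K%:Z -> forall z : int, `|z| <= M%:Z ->
  belt_orbit c t z = belt_orbit c' t z /\ `|(belt_orbit c t z).1| <= `|t.1| + (M * R)%N%:Z.
Proof.
move=> h ht.
have iter_local (F : (int -> bool) -> int * bool -> int * bool) :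
    (forall s : int * bool, `|s.1| + R%:Z <= K%:Z -> F c s = F c' s) ->
    (forall s : int * bool, `|(F c s).1 - s.1| <= R%:Z) -> forall k, (k <= M)%N ->
    iter k (F c) t = iter k (F c') t /\ `|(iter k (F c) t).1| <= `|t.1| + (k * R)%N%:Z.
  move=> Floc Fnear; elim=> [|k IH] kM; first by split=> //=; lia.
  have [e1 e2] := IH (ltnW kM); have := Fnear (iter k (F c) t).
  have kR : (k * R + R <= M * R)%N by rewrite addnC -mulSn leq_mul2r kM orbT.
  move: ht; rewrite mulSn => ht.
  rewrite !iterS -e1 => near; split; last by rewrite mulSn; lia.
  by apply: Floc; lia.
have next_loc := iter_local belt_next (fun s => belt_next_local h) (belt_next_near c).
have prev_loc : forall k, (k <= M)%N -> iter k (belt_prev c) t = iter k (belt_prev c') t /\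
    `|(iter k (belt_prev c) t).1| <= `|t.1| + (k * R)%N%:Z.
  apply: (iter_local belt_prev) => s; first by move=> hs; rewrite /belt_prev (belt_next_local h).
  exact: (belt_next_near c (flip s)).
case=> k hk; [have kM : (k <= M)%N by lia | have kM : (k.+1 <= M)%N by lia].
  have [e1 e2] := next_loc _ kM; split=> //; apply: le_trans e2 _.
  by rewrite lerD2l lez_nat leq_mul2r kM orbT.
have [e1 e2] := prev_loc _ kM; split=> //; apply: le_trans e2 _.
by rewrite lerD2l lez_nat leq_mul2r kM orbT.
Qed.

Lemma belt_next_shift c t :
  belt_next c (t.1 + 1, t.2) =
  ((belt_next (fun i => c (i + 1)) t).1 + 1, (belt_next (fun i => c (i + 1)) t).2).
Proof.
have ls i j : linked (fun i => c (i + 1)) i j <-> linked c (i + 1) (j + 1).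
  rewrite !linkedP; split=> -[h1 h2 h3 h4]; split=> //; try lia.
    move=> k hk; have := h4 (k - 1); rewrite subrK; apply; lia.
  move=> k hk; apply: h4; lia.
case: (belt_nextP (fun i => c (i + 1)) t) => [[j [/ls h tb ->]]|[j [/ls h tb ->]]|e].
- by rewrite tb (linked_next h).
- by rewrite (negbTE tb) (linked_prev h).
rewrite e; case: (belt_nextP c (t.1 + 1, t.2)) => [[j [/= h tb _]]|[j [/= h tb _]]|->] //.
  have := @linked_next (fun i => c (i + 1)) t.1 (j - 1).
  rewrite ls subrK => /(_ h); move: e; rewrite /flip; case: (t) tb => i b /= -> -> [] //.
have := @linked_prev (fun i => c (i + 1)) (j - 1) t.1.
rewrite ls subrK => /(_ h); move: e; rewrite /flip; case: (t) tb => i b /= /negbTE -> -> [] //.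
Qed.

Lemma belt_orbit_shift c t z :
  belt_orbit c (t.1 + 1, t.2) z =
  ((belt_orbit (fun i => c (i + 1)) t z).1 + 1, (belt_orbit (fun i => c (i + 1)) t z).2).
Proof.
case: z => k; rewrite /belt_orbit; last move: k.+1 => {}k.
  by elim: k => //= k ->; rewrite belt_next_shift.
elim: k => //= k ->; move: (iter k _ t) => s.
by have := belt_next_shift c (flip s); rewrite /belt_prev /flip /= => ->.
Qed.

End Belt.

(** * The action of automorphisms of the full shift along the belts *)

Section ConveyorBelt.
Variables (A : finType) (theta : rsubst A) (P Q : seq A) (e : bool * bool -> seq A) (m n : nat).
Hypothesis mc : marked_cell theta P Q e m n.
Variable R : nat.
Implicit Types (x y : config A) (i : int) (t : int * bool) (f g : config bool -> config bool).

Definition cell_bit x t : bool :=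
  if t.2 then (cell_data P Q e m x t.1).1 else (cell_data P Q e m x t.1).2.

(** The slot [t] sits at coordinate 0. A finite chain of cells closes up to a loop and gives a
    periodic sequence. *)
Definition track x t : config bool :=
  fun z => cell_bit x (belt_orbit R (is_cell P Q e m x) t z).

Definition belt_act f x : config A :=
  update P Q e m x (fun i => (f (track x (i, true)) 0, f (track x (i, false)) 0)).

Lemma is_cell_act f x : is_cell P Q e m (belt_act f x) = is_cell P Q e m x.
Proof. by apply/funext => i; apply: is_cell_update mc _ _ _. Qed.

Lemma cell_bit_act f x t : is_cell P Q e m x t.1 -> cell_bit (belt_act f x) t = f (track x t) 0.
Proof. by case: t => i [] hi; rewrite /cell_bit /= (cell_data_update mc). Qed.

Lemma track_next x t : track x (belt_next R (is_cell P Q e m x) t) = shift (track x t).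
Proof. by apply/funext => z; rewrite /track belt_orbit_next. Qed.

(** The action keeps the cells, hence the belts. The new bit [z] steps along is coordinate 0 of [f]
    on the track shifted by [z], which is coordinate [z] of [f] on the original track. *)
Lemma track_act f x t : (forall u, f (shift u) = shift (f u)) -> is_cell P Q e m x t.1 ->
  track (belt_act f x) t = f (track x t).
Proof.
move=> fS ht; apply/funext => z; rewrite /track is_cell_act cell_bit_act; last exact: belt_orbit_cell.
rewrite (shift_orbit (h := fun z => f (track x (belt_orbit R _ t z)))) ?add0r //.
by move=> z'; rewrite belt_orbitS track_next fS.
Qed.

Lemma belt_act_comp f g x : (forall u, g (shift u) = shift (g u)) ->
  belt_act (fun u => f (g u)) x = belt_act f (belt_act g x).
Proof.
move=> gS; rewrite {2}/belt_act [in RHS]/belt_act (update_update mc).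
by apply: eq_update => i hi; rewrite !track_act.
Qed.

Lemma belt_act_id x : belt_act (fun u => u) x = x.
Proof.
rewrite -[RHS](update_cell_data mc); apply: eq_update => i hi.
by rewrite /track /cell_bit /= -surjective_pairing.
Qed.

Lemma track_shift x i b : track (shift x) (i, b) = track x (i + 1, b).
Proof.
apply/funext => z; rewrite /track.
have -> : is_cell P Q e m (shift x) = (fun i => is_cell P Q e m x (i + 1)).
  by apply/funext => j; rewrite is_cell_shift.
have := belt_orbit_shift R (is_cell P Q e m x) (i, b) z; rewrite /= => ->.
by rewrite /cell_bit cell_data_shift.
Qed.

Lemma belt_act_shift f x : belt_act f (shift x) = shift (belt_act f x).
Proof. by apply: update_shift => i; rewrite !track_shift. Qed.

Lemma belt_act_X f x : X_theta theta x -> X_theta theta (belt_act f x).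
Proof. exact: (X_update mc). Qed.

Lemma track_local x y t (K M : nat) : agree K x y ->
  `|t.1| + (M.+1 * R)%N%:Z + (pattern_size P Q m)%:Z <= K%:Z -> agree M (track x t) (track y t).
Proof.
move=> xy hK z hz; set s := pattern_size P Q m in hK.
have loc j : `|j| <= (K - s)%N%:Z -> is_cell P Q e m x j = is_cell P Q e m y j /\
    cell_data P Q e m x j = cell_data P Q e m y j.
  by move=> hj; apply: is_cell_local => k; rewrite -/s => hk; apply: xy; lia.
have [|||e1 e2] := @belt_orbit_local R (is_cell P Q e m x) (is_cell P Q e m y) t (K - s) M _ _ z.
- by move=> k /loc[].
- by lia.
- by lia.
rewrite /track -e1 /cell_bit; move: (belt_orbit _ _ _ _) {e1} e2 => u hu.
suff /loc[_ ->] : `|u.1| <= (K - s)%N%:Z by [].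
by move: hK hu; rewrite mulSn; clear; move: (M * R)%N `|t.1| `|u.1|; lia.
Qed.

Lemma belt_act_cont (X : config A -> Prop) f : cont_on (@full_shift bool) f -> cont_on X (belt_act f).
Proof.
move=> fc x _ N; set s := pattern_size P Q m.
(* [belt_act] reads [f] only at coordinate 0, so continuity is needed there only, with a modulus [M]
   depending on the track. *)
pose ok t M := forall u, agree M (track x t) u -> f (track x t) 0 = f u 0.
have okmon t a b : (a <= b)%N -> ok t a -> ok t b.
  by move=> ab h u hu; apply: h => i hi; apply: hu; lia.
have okex t : exists a, ok t a.
  have [a ha] := fc (track x t) I 0%N; exists a => u hu.
  by apply: (ha u I hu).
pose K := (N + s)%N.
(* Only finitely many slots, with cells starting within [K] of the origin, influence the window, so
   one modulus serves them all. *)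
have [M hM] := @finite_bound _ [seq (- K%:Z + (k : nat)%:Z, b) | k <- iota 0 (K + K).+1, b <- [:: true; false]]
  ok okmon okex.
have {}hM i b : `|i| <= K%:Z -> ok (i, b) M.
  move=> hi; apply: hM; apply/allpairsP; exists (absz (i + K%:Z)%R, b).
  rewrite mem_iota !inE; split=> /=; [lia | by case: b | congr (_, _); lia].
exists (K + M.+1 * R + s)%N => y _ xy k hk.
apply: (update_local mc) => [j hj|i hi _].
  by apply: xy; rewrite -/s in hj; lia.
have agr b : agree M (track x (i, b)) (track y (i, b)).
  by apply: track_local xy _; rewrite -/s in hi *; rewrite /=; lia.
have iK : `|i| <= K%:Z by move: hi; rewrite -/s /K; clear -hk; lia.
have ft b : f (track x (i, b)) 0 = f (track y (i, b)) 0 by exact (hM i b iK _ (agr b)).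
exact (f_equal2 pair (ft true) (ft false)).
Qed.

Lemma belt_act_aut f : is_aut (@full_shift bool) f -> is_aut (X_theta theta) (belt_act f).
Proof.
move=> [_ fS fc [g [_ gc gf fg]]].
(* The inverse of a shift-commuting bijection commutes with the shift, so [belt_act g] inverts
   [belt_act f]. *)
have gS u : g (shift u) = shift (g u).
  by rewrite -[in LHS](fg u I) -fS // gf.
split=> [x|x _||]; [exact: belt_act_X|exact: belt_act_shift|exact: belt_act_cont|].
exists (belt_act g); split=> [x|| x _|x _]; [exact: belt_act_X|exact: belt_act_cont| |].
  rewrite -belt_act_comp => [|u]; last exact: fS.
  by rewrite -[RHS]belt_act_id; congr (belt_act _ x); apply/funext => u; apply: gf.
rewrite -belt_act_comp //.
by rewrite -[RHS]belt_act_id; congr (belt_act _ x); apply/funext => u; apply: fg.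
Qed.

(** By continuity [f u 0] and [g u 0] depend on finitely many coordinates of [u]. These are written
    on the upper bits of a long chain of cells, and the action is read off at the middle cell. *)
Lemma belt_act_inj f g : is_aut (@full_shift bool) f -> is_aut (@full_shift bool) g ->
  (forall K : nat, exists x, X_theta theta x /\ forall i : int, 0 <= i <= K%:Z ->
    exists j, i < j <= i + R%:Z /\ is_cell P Q e m x j) ->
  (forall x, X_theta theta x -> belt_act f x = belt_act g x) -> f = g.
Proof.
(* Commutation with the shift reduces equality to coordinate 0. *)
move=> [_ fS fc _] [_ gS gc _] chain fg; suff fg0 u : f u 0 = g u 0.
  apply/funext => u; apply/funext => z.
  pose v z' : config bool := fun w => u (w + z').
  have vS z' : v (z' + 1) = shift (v z') by apply/funext => w; rewrite /v /shift; congr u; lia.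
  have v0 : u = v 0 by apply/funext => w; rewrite /v addr0.
  have := shift_orbit (h := fun z' => f (v z')) _ z 0; rewrite add0r -v0 => <-; last first.
    by move=> z'; rewrite vS fS.
  have := shift_orbit (h := fun z' => g (v z')) _ z 0; rewrite add0r -v0 => <-; last first.
    by move=> z'; rewrite vS gS.
  exact: fg0.
have [a ha] := fc u I 0%N; have [b hb] := gc u I 0%N; pose M := maxn a b.
(* The first cell lies within [R] of the origin, and [2M + 1] further steps of length at most [R]
   must stay in range. *)
have [x [Xx xc]] := chain ((M + M).+2 * R)%N.
pose c := is_cell P Q e m x.
have [i0 [i0R c0]] : exists j, 0 < j <= 0 + R%:Z /\ c j by apply: xc; lia.
pose pos k := (iter k (belt_next R c) (i0, true)).1.
have link i : c i -> 0 <= i <= ((M + M).+2 * R)%N%:Z -> exists j, linked R c i j.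
  move=> ci /xc[j0 [ij0 cj0]].
  have ex : exists k : nat, c (i + k.+1%:Z).
    exists (absz (j0 - i - 1)%R); have -> // : i + (absz (j0 - i - 1)%R).+1%:Z = j0 by lia.
  (* The nearest cell to the right of [i] is the linked one. *)
  case: (ex_minnP ex) => k ck kmin; exists (i + k.+1%:Z).
  have kj0 : (k <= absz (j0 - i - 1)%R)%N.
    by apply: kmin; have -> : i + (absz (j0 - i - 1)%R).+1%:Z = j0 by lia.
  apply/linkedP; split=> // [|k' hk']; first by lia.
  apply/negP => ck'; have := kmin (absz (k' - i - 1)%R).
  have -> : i + (absz (k' - i - 1)%R).+1%:Z = k' by lia.
  by move/(_ ck'); lia.
have step k : (k <= M + M)%N -> iter k (belt_next R c) (i0, true) = (pos k, true) ->
    c (pos k) -> 0 <= pos k <= (k.+1 * R)%N%:Z ->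
    [/\ iter k.+1 (belt_next R c) (i0, true) = (pos k.+1, true), c (pos k.+1) &
        pos k < pos k.+1 <= pos k + R%:Z].
  move=> kM ek ck pk; have kR : (k.+1 * R <= (M + M).+2 * R)%N by rewrite leq_mul2r; lia.
  have [|j hj] := link _ ck; first by lia.
  have ek1 : iter k.+1 (belt_next R c) (i0, true) = (j, true) by rewrite iterS ek (linked_next hj).
  by rewrite /pos ek1 /= -/(pos k); have /linkedP[_ cj ij _] := hj.
have posP k : (k <= (M + M).+1)%N ->
    [/\ iter k (belt_next R c) (i0, true) = (pos k, true), c (pos k) &
        0 <= pos k <= (k.+1 * R)%N%:Z].
  elim: k => [|k IH] kM; first by rewrite /pos /= mul1n; split=> //; lia.
  have [ek ck pk] := IH (ltnW kM); have [ek1 ck1 pk1] := step k kM ek ck pk.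
  by split=> //; move: pk; rewrite [(k.+2 * R)%N]mulSn; lia.
have pos_lt k : (k <= M + M)%N -> pos k < pos k.+1.
  by move=> kM; have [ek ck pk] := posP k (leqW kM); have [_ _ /andP[]] := step k kM ek ck pk.
have pos_mono k d : (k + d <= M + M)%N -> pos k < pos (k + d).+1.
  elim: d => [|d IH] kd; first by rewrite addn0 in kd *; apply: pos_lt.
  apply: lt_trans (IH _) _; first by lia.
  by rewrite addnS; apply: pos_lt; rewrite addnS in kd.
pose ks := [seq pos k | k <- iota 0 (M + M).+1].
have uks : uniq ks.
  rewrite map_inj_in_uniq ?iota_uniq // => k k'; rewrite !mem_iota => hk hk' E.
  have [lt|[lt|//]] : (k < k')%N \/ (k' < k)%N \/ k = k' by lia.
    have := @pos_mono k (k' - k.+1)%N; have -> : (k + (k' - k.+1)).+1 = k' by lia.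
    by rewrite E ltxx => /(_ ltac:(lia)).
  have := @pos_mono k' (k - k'.+1)%N; have -> : (k' + (k - k'.+1)).+1 = k by lia.
  by rewrite E ltxx => /(_ ltac:(lia)).
(* The cell at [pos k] stores the value of [u] at [k - M], so [pos M] carries coordinate 0; lower
   bits are arbitrary. *)
pose D i := (u (Posz (index i ks) - M%:Z), false).
pose y := update P Q e m x D.
have Xy : X_theta theta y by apply: (X_update mc).
have cy : is_cell P Q e m y = c by apply/funext => i; apply: (is_cell_update mc).
have uy : agree M u (track y (pos M, true)).
  move=> z hz; have [<- _ _] := posP M ltac:(lia).
  (* The track from the middle cell is the track from [i0] moved by [M], so its coordinate [z] is
     read at [pos (z + M)]. *)
  have := shift_orbit (h := fun z' => track y (belt_orbit R c (i0, true) z')) _ M%:Z z.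
  rewrite /= => ->; last by move=> z'; rewrite belt_orbitS -cy track_next.
  have [k [ek kM]] : exists k : nat, z + M%:Z = k%:Z /\ (k <= M + M)%N.
    by exists (absz (z + M%:Z)%R); lia.
  have [pk ck _] := posP k (leqW kM).
  rewrite ek /track cy /= pk /cell_bit /= (cell_data_update mc) //.
  have ik : index (pos k) ks = k.
    have {1}-> : pos k = nth 0 ks k by rewrite (nth_map 0%N) ?size_iota ?nth_iota //; lia.
    by rewrite index_uniq // size_map size_iota.
  by rewrite /D ik; congr u; lia.
have ct : is_cell P Q e m y (pos M, true).1 by rewrite cy; have [] := posP M ltac:(lia).
have := congr1 (fun x => cell_bit x (pos M, true)) (fg _ Xy).
rewrite /= !cell_bit_act // => E.
have fu : f u 0 = f (track y (pos M, true)) 0.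
  by apply: (ha _ I) => // i hi; apply: uy; rewrite /M; lia.
have gu : g u 0 = g (track y (pos M, true)) 0.
  by apply: (hb _ I) => // i hi; apply: uy; rewrite /M; lia.
by rewrite fu gu.
Qed.

End ConveyorBelt.

Theorem theorem6p12 (A : finType) (theta : rsubst A) (L : nat) :
  is_random_subst theta ->
  nondeterministic theta ->
  constant_length theta L ->
  primitive theta ->
  compatible theta ->
  admits_recognisable_word theta ->
  aut_embeds (@full_shift bool) (X_theta theta).
Proof.
move=> ok nd len prim comp _.
(* Two distinct images of one letter have equal letter counts by compatibility, so they cannot be
   single letters; length 0 is excluded by non-emptiness. *)
have L2 : (1 < L)%N.
  have [a ha] := nd; case E: (undup (theta a)) ha => [|u [|v s]] //= _.
  have [hu hv uv] : [/\ u \in theta a, v \in theta a & u != v].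
    rewrite -!(mem_undup (theta a)) E !inE !eqxx orbT; split=> //.
    by have := undup_uniq (theta a); rewrite E /= inE negb_or -andbA => /andP[].
  have := comp a u v hu hv; have := ok.2 a u hu; have := len a u hu; have := len a v hv.
  rewrite ltnNge; case: u v uv {hu hv E} => [|b [|b' u]] [|d [|d' v]] //= bd sv su; try by lia.
  by move=> _ /(_ b); rewrite eqxx; case: (eqVneq d b) bd => [->|_ _ //]; rewrite eqxx.
have [P [Q [e [m [n mc]]]]] := marked_cell_ex len ok prim nd L2.
(* The turning distance [R] is the recurrence gap of one fixed pattern, which guarantees arbitrarily
   long chains of cells. *)
have [R chain] := syndetic_config len ok prim L2 (cell_legal mc (true, true)).
have {}chain K : exists x, X_theta theta x /\ forall i : int, 0 <= i <= K%:Z ->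
    exists j, i < j <= i + R%:Z /\ is_cell P Q e m x j.
  have [x [Xx h]] := chain K; exists x; split=> // i /h[j [hj hw]]; exists j; split=> //.
  by apply/is_cellP; exists (true, true); rewrite -(size_pattern mc (true, true)).
exists (belt_act P Q e m R); split=> [f|f g _ [_ gS _ _] x _|f g hf hg /(belt_act_inj mc hf hg chain) -> //].
  exact: (belt_act_aut mc).
by apply: (belt_act_comp mc) => u; apply: gS.
Qed.
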